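(* Let $b\in\mathcal B$ and put $\varepsilon_b(p)=(-1)^{|p\cap\operatorname{supp}(b)|}$ for $p\in\mathcal P$, and $\theta_b(e_p)=\varepsilon_b(p)e_p$. Then, for every decoration $\delta$, the (linearly extended) map $\theta_b$ is an involutive automorphism of $\mathbb A^\delta(G_2(m))$, and its eigenspace decomposition is $$\mathbb A^\delta=\mathbb A_+(b)\oplus\mathbb A_-(b),\qquad \mathbb A_+(b)=\mathbb V_{\mathcal P_0}\oplus\mathbb V_{\mathcal P_2},\qquad \mathbb A_-(b)=\mathbb V_{\mathcal P_1}=\bigoplus_{r\in R}\mathbb V_{W_r},$$ where $\{i,j,k\}=\operatorname{supp}(b)$, $R=\Omega\setminus\{i,j,k\}$, $\mathcal P_0=b=\{ij,ik,jk\}$, $W_r=\{ir,jr,kr\}$, $\mathcal P_1=\bigsqcup_{r\in R}W_r$, $\mathcal P_2=\{rs:r,s\in R,\ r\neq s\}$, and $\mathbb A_\pm(b)$ is the eigenspace of $\theta_b$ for the eigenvalue $\pm1$.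
   Context: Let $K$ be a field of characteristic $0$, $m\ge 3$ an integer and $\Omega=\{1,\dots,m\}$. The Grassmannian geometry $G_2(m)$ has point set $\mathcal P=\binom{\Omega}{2}$ (the point $\{i,j\}$ is written $ij$) and block set $\mathcal B$ consisting of the triples $b_{ijk}=\{ij,ik,jk\}$, one for each $3$-subset $\{i,j,k\}\subseteq\Omega$; $\operatorname{supp}(b_{ijk})=\{i,j,k\}$. A decoration is a map $\delta:\mathcal B\to\{\pm1\}$. The decorated incidence algebra $\mathbb A^\delta=\mathbb A^\delta(G_2(m))$ is the commutative (nonassociative) $K$-algebra with basis $\{e_p:p\in\mathcal P\}$ and bilinear product $e_{ij}\circ_\delta e_{ik}=\delta(b_{ijk})e_{jk}$ for distinct $i,j,k\in\Omega$, and $e_p\circ_\delta e_q=0$ if $p=q$ or $p\cap q=\varnothing$. For $S\subseteq\mathcal P$, $\mathbb V_S=\operatorname{span}_K\{e_p:p\in S\}$. *)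

(* Defs.v *)
From HB Require Import structures.
From mathcomp Require Import all_boot all_order all_algebra.

Set Implicit Arguments.
Unset Strict Implicit.
Unset Printing Implicit Defensive.

Import GRing.Theory.
Local Open Scope ring_scope.

Section Geometry.
Variable m : nat.

Definition point : predArgType := {p : {set 'I_m} | #|p| == 2%N}.

Definition points (s : seq {set 'I_m}) : {set point} :=
  [set p : point | val p \in s].

Definition triple (i j k : 'I_m) : {set point} :=
  points [:: [set i; j]; [set i; k]; [set j; k]].

Definition is_block (B : {set point}) : bool :=
  [exists i, exists j, exists k,
     [&& i != j, i != k, j != k & B == triple i j k]].

Definition block : predArgType := {B : {set point} | is_block B}.

(* Blocks are sets of points; the support of b_ijk is recovered as the union *)
(* of its three points, see [supp_triple].                                   *)
Definition supp (b : block) : {set 'I_m} := \bigcup_(p in val b) val p.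

Definition sign : predArgType := {s : int | (s == 1) || (s == -1)}.

Definition decoration : Type := block -> sign.

Lemma mem_triple (i j k : 'I_m) (p : point) :
  i != j -> i != k -> j != k ->
  (p \in triple i j k) = (val p \subset [set i; j; k]).
Proof.
move=> ij ik jk; rewrite !inE; apply/idP/idP.
  by case/or3P=> /eqP->; apply/subsetP => x; rewrite !inE => /orP[] /eqP->;
     rewrite eqxx ?orbT.
have /cards2P[x [y [xy ->]]]: #|val p| == 2%N by exact: (valP p).
move=> /subsetP S.
have:= S x (set21 _ _); have:= S y (set22 _ _); rewrite !inE -!orbA.
by move=> /or3P[] /eqP yE /or3P[] /eqP xE; move: xy;
   rewrite xE yE ?eqxx ?orbT // => _; rewrite setUC eqxx ?orbT.
Qed.

Lemma pair_card2 (i j : 'I_m) : i != j -> #|[set i; j]| == 2%N.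
Proof. by move=> ij; rewrite cards2 ij. Qed.

Lemma supp_triple (b : block) (i j k : 'I_m) :
  i != j -> i != k -> j != k -> val b = triple i j k -> supp b = [set i; j; k].
Proof.
move=> ij ik jk bE; apply/setP => x; apply/bigcupP/idP => [[p]|].
  by rewrite bE mem_triple // => /subsetP S; apply: S.
rewrite !inE -orbA => /or3P[] /eqP->.
- by exists (Sub [set i; j] (pair_card2 ij) : point);
    rewrite ?bE !inE /= ?inE eqxx ?orbT.
- by exists (Sub [set i; j] (pair_card2 ij) : point);
    rewrite ?bE !inE /= ?inE eqxx ?orbT.
- by exists (Sub [set i; k] (pair_card2 ik) : point);
    rewrite ?bE !inE /= ?inE eqxx ?orbT.
Qed.

Lemma block_suppE (b : block) :
  #|supp b| = 3%N /\ val b = [set p : point | val p \subset supp b].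
Proof.
case/existsP: (valP b) => i /existsP[j /existsP[k /and4P[ij ik jk /eqP bE]]].
have sE := supp_triple ij ik jk bE; split.
  by rewrite sE setUC cardsU1 cards2 !inE ij negb_or eq_sym ik eq_sym jk.
by apply/setP => p; rewrite sE bE mem_triple // inE.
Qed.

End Geometry.

Section Algebra.
Variables (K : fieldType) (m : nat).

(* Underlying vector space of the decorated incidence algebras: [x p] is the *)
(* coordinate of [x] along e_p.                                              *)
Definition dvect : predArgType := {ffun point m -> K^o}.

Definition e (p : point m) : dvect := [ffun q => (q == p)%:R].

(* Two distinct points p, q lie in at most one block B = {p, q, r}, so the    *)
(* double sum has at most one term, delta(B) e_r; see [dmul_adj], [dmul_eq0]. *)
Definition dmul_basis (delta : decoration m) (p q : point m) : dvect :=
  \sum_(B : block m | [&& p != q, p \in val B & q \in val B])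
    \sum_(r in val B :\: [set p; q]) (val (delta B))%:~R *: e r.

Definition dmul (delta : decoration m) (x y : dvect) : dvect :=
  \sum_p \sum_q (x p * y q) *: dmul_basis delta p q.

Definition automorphism (delta : decoration m) (f : 'End(dvect)) : Prop :=
  bijective f /\ {morph f : x y / dmul delta x y}.

Definition VS (S : {set point m}) : {vspace dvect} :=
  <<[seq e p | p in S]>>%VS.

Definition eps (b : block m) (p : point m) : K :=
  (-1) ^+ #|val p :&: supp b|.

Definition theta_fun (b : block m) (x : dvect) : dvect :=
  \sum_p x p *: (eps b p *: e p).

Definition theta (b : block m) : 'End(dvect) := linfun (theta_fun b).

Lemma theta_fun_is_linear b : linear (theta_fun b).
Proof.
move=> a x y; rewrite /theta_fun scaler_sumr -big_split /=.
by apply: eq_bigr => p _; rewrite !ffunE scalerDl;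
   congr (_ + _); rewrite [RHS]scalerA.
Qed.
HB.instance Definition _ b :=
  GRing.isLinear.Build K dvect dvect *:%R (theta_fun b) (theta_fun_is_linear b).

Lemma theta_e b p : theta b (e p) = eps b p *: e p.
Proof.
rewrite lfunE /= /theta_fun (bigD1 p) //= ffunE eqxx scale1r big1 ?addr0 //.
by move=> q /negbTE qp; rewrite ffunE qp scale0r.
Qed.

Lemma dvect_sum_e (x : dvect) : x = \sum_p x p *: e p.
Proof.
apply/ffunP => q; rewrite sum_ffunE (bigD1 q) //= !ffunE eqxx.
rewrite big1 ?addr0 => [|p pq]; first by rewrite /GRing.scale /= mulr1.
by rewrite !ffunE eq_sym (negbTE pq) scaler0.
Qed.

Lemma dmul_linear_l delta y : linear (dmul delta ^~ y).
Proof.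
move=> a x x'; rewrite /dmul scaler_sumr -big_split; apply: eq_bigr => p _ /=.
rewrite scaler_sumr -big_split; apply: eq_bigr => q _ /=.
by rewrite !ffunE mulrDl scalerDl scalerA mulrA.
Qed.

Lemma dmul_linear_r delta x : linear (dmul delta x).
Proof.
move=> a y y'; rewrite /dmul scaler_sumr -big_split; apply: eq_bigr => p _ /=.
rewrite scaler_sumr -big_split; apply: eq_bigr => q _ /=.
by rewrite !ffunE mulrDr scalerDl scalerA mulrCA.
Qed.

Lemma dmul_e delta p q : dmul delta (e p) (e q) = dmul_basis delta p q.
Proof.
rewrite /dmul (bigD1 p) //= (bigD1 q) //= !ffunE !eqxx mulr1 scale1r.
rewrite [X in _ + X + _]big1 ?addr0 => [|q' qq]; last first.
  by rewrite !ffunE (negbTE qq) mulr0 scale0r.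
rewrite big1 ?addr0 // => p' pp; apply: big1 => q' _.
by rewrite !ffunE (negbTE pp) mul0r scale0r.
Qed.

Lemma dmulC delta : commutative (dmul delta).
Proof.
move=> x y; rewrite /dmul exchange_big; apply: eq_bigr => q _ /=.
apply: eq_bigr => p _; rewrite mulrC /dmul_basis setUC; congr (_ *: _).
by apply: eq_bigl => B; rewrite eq_sym; congr (_ && _); rewrite andbC.
Qed.

Lemma dmul_adj delta (i j k : 'I_m) (p q r : point m) (B : block m) :
  i != j -> i != k -> j != k ->
  val p = [set i; j] -> val q = [set i; k] -> val r = [set j; k] ->
  val B = triple i j k ->
  dmul delta (e p) (e q) = (val (delta B))%:~R *: e r.
Proof.
move=> ij ik jk pE qE rE BE.
have pq : p != q.
  apply/eqP => /(congr1 val); rewrite pE qE => /setP/(_ j).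
  by rewrite !inE eqxx orbT eq_sym (negbTE ij) (negbTE jk).
have pr : p != r.
  apply/eqP => /(congr1 val); rewrite pE rE => /setP/(_ i).
  by rewrite !inE eqxx (negbTE ij) (negbTE ik).
have qr : q != r.
  apply/eqP => /(congr1 val); rewrite qE rE => /setP/(_ i).
  by rewrite !inE eqxx (negbTE ij) (negbTE ik).
have BE' : val B = [set p; q; r].
  apply/setP => x; rewrite BE !inE -pE -qE -rE !(inj_eq val_inj).
  by rewrite orbA.
have sB := supp_triple ij ik jk BE.
rewrite dmul_e /dmul_basis (big_pred1 B) => [|B']; last first.
  apply/idP/eqP => [|->]; last by rewrite pq BE' !inE !eqxx orbT.
  have [c3 B'E] := block_suppE B'; have [c3' B1E] := block_suppE B.
  rewrite B'E !inE pE qE => /and3P[_ s1 s2].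
  have /eqP sE : supp B == supp B'.
    rewrite eqEcard c3 c3' leqnn andbT sB !subUset.
    by move: s1 s2; rewrite !subUset => /andP[-> ->] /andP[].
  by apply: val_inj; rewrite B'E B1E sE.
rewrite (big_pred1 r) // => x; rewrite BE' !inE /=.
case: (eqVneq x r) => [->|_]; last by rewrite orbF andNb.
by rewrite orbT andbT negb_or ![r == _]eq_sym pr qr.
Qed.

Lemma dmul_eq0 delta (p q : point m) :
  p = q \/ [disjoint val p & val q] -> dmul delta (e p) (e q) = 0.
Proof.
rewrite dmul_e => pq; rewrite /dmul_basis big_pred0 // => B.
apply/negbTE/and3P => -[npq].
case: pq npq => [->|dpq _]; first by rewrite eqxx.
have [c3 BE] := block_suppE B; rewrite BE !inE => s1 s2.
have: (#|val p :|: val q| <= 3)%N by rewrite -c3 subset_leq_card // subUset s1.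
rewrite cardsU (eqP (valP p)) (eqP (valP q)).
by move: dpq; rewrite -setI_eq0 => /eqP->; rewrite cards0.
Qed.

Lemma e_basis : basis_of fullv [seq (e p : dvect) | p : point m].
Proof.
rewrite basisEdim size_map -cardE dimvf /dim /= muln1 leqnn andbT.
apply/subvP => x _; rewrite [x]dvect_sum_e; apply: memv_suml => p _.
by apply/memvZ/memv_span/map_f; rewrite mem_enum.
Qed.

End Algebra.

Arguments e {K m} p.
Arguments theta K {m} b.
Arguments VS K {m} S.

(* Main.v *)
(* The map theta_b is diagonal in the basis (e_p), with entries +-1, so its     *)
(* eigenspaces are spanned by the e_p with eps_b(p) = 1, i.e. p inside or       *)
(* disjoint from supp b, and by those with eps_b(p) = -1, i.e. p meeting supp b *)
(* in one element. Multiplicativity of theta_b reduces to the fact that eps_b   *)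
(* is multiplicative along each block.                                          *)
Require Import Defs.
From HB Require Import structures.
From mathcomp Require Import all_boot all_order all_algebra.

Import GRing.Theory.
Local Open Scope ring_scope.

(** Everything is read off coordinates. [theta K b] multiplies the coordinate at [p] by the sign
    [eps K b p] ([theta_coord]), hence is its own inverse; and [VS K S] consists of the vectors
    whose coordinates vanish off [S] ([mem_VS]). So each eigenspace is [VS K] of a level set of
    [eps] ([leigenspace_theta]), and sums and direct sums of the spaces [VS K S] become unions and
    disjointness of sets of points. It remains to identify the level sets, by counting how many of
    the two ends of a point lie in [supp b]. For the product, every [e r] occurring in
    [dmul_basis K delta p q] satisfies [eps r = eps p * eps q] ([eps_block]), whatever the signs of
    [delta]. *)

Lemma point_pair {m : nat} (p : point m) :
  exists x y : 'I_m, x != y /\ val p = [set x; y].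
Proof. by have /cards2P[x [y [xy ->]]] := valP p; exists x, y. Qed.

Lemma block_triple {m : nat} (B : block m) :
  exists i j k, [/\ i != j, i != k, j != k & val B = triple i j k].
Proof.
case/existsP: (valP B) => i /existsP[j /existsP[k /and4P[ij ik jk /eqP BE]]].
by exists i, j, k.
Qed.

Lemma card_pairI (T : finType) (x y : T) (S : {set T}) :
  x != y -> #|[set x; y] :&: S| = ((x \in S) + (y \in S))%N.
Proof.
move=> xy; rewrite -sum1_card; under eq_bigl do rewrite inE.
by rewrite big_mkcondr big_setU1 ?inE // big_set1; do 2 case: (_ \in S).
Qed.

Lemma epsE {K : fieldType} {m : nat} (b : block m) (p : point m) (x y : 'I_m) :
  x != y -> val p = [set x; y] ->
  eps K b p = (-1) ^+ (x \in supp b) * (-1) ^+ (y \in supp b).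
Proof. by move=> xy pE; rewrite /eps pE card_pairI // exprD. Qed.

Lemma eps_sqr {K : fieldType} {m : nat} (b : block m) (p : point m) :
  eps K b p * eps K b p = 1.
Proof. by rewrite -expr2 /eps sqrr_sign. Qed.

(* Each element of the support of [B] lies on exactly two of the three points  *)
(* of [B], so the product of the signs of these points is a square.            *)
Lemma eps_block {K : fieldType} {m : nat} (b B : block m) (p q r : point m) :
  p != q -> p \in val B -> q \in val B -> r \in val B :\: [set p; q] ->
  eps K b r = eps K b p * eps K b q.
Proof.
have [i [j [k [ij ik jk ->]]]] := block_triple B.
have vE := inj_eq (val_inj : injective (val : point m -> {set 'I_m})).
rewrite !inE -!vE negb_or => pq pB qB /andP[/andP[rp rq] rB].
(* As [p], [q], [r] are distinct, they are the three pairs in one of six orders; each case is an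
   identity of exclusive ors in the memberships of [i], [j], [k] in [supp b]. *)
case/or3P: pB pq rp => /eqP pE; rewrite pE;
  case/or3P: qB rq => /eqP qE; rewrite qE ?eqxx //;
  case/or3P: rB => /eqP rE; rewrite rE ?eqxx //= => _ _ _;
  rewrite (epsE _ _ _ _ _ pE) // (epsE _ _ _ _ _ qE) //
          (epsE _ _ _ _ _ rE) //.
all: rewrite -!signr_addb; congr (_ ^+ nat_of_bool _).
all: by case: (i \in _); case: (j \in _); case: (k \in _).
Qed.

Lemma scale_coord {K : fieldType} {m : nat} (a : K) (x : dvect K m) p :
  (a *: x) p = a * x p.
Proof. by rewrite ffunE. Qed.

Lemma theta_coord {K : fieldType} {m : nat} (b : block m) (x : dvect K m) p :
  theta K b x p = eps K b p * x p.
Proof.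
rewrite lfunE /= /theta_fun sum_ffunE (bigD1 p) //= big1 => [|q qp].
  by rewrite addr0 !scale_coord ffunE eqxx mulr1 mulrC.
by rewrite !scale_coord ffunE eq_sym (negbTE qp) !mulr0.
Qed.

Lemma theta_invol {K : fieldType} {m : nat} (b : block m) :
  involutive (theta K b).
Proof.
by move=> x; apply/ffunP => p; rewrite !theta_coord mulrA eps_sqr mul1r.
Qed.

Lemma theta_dmul_basis {K : fieldType} {m : nat} (b : block m)
    (delta : decoration m) p q :
  theta K b (dmul_basis K delta p q)
    = (eps K b p * eps K b q) *: dmul_basis K delta p q.
Proof.
rewrite /dmul_basis linear_sum scaler_sumr; apply: eq_bigr => B /and3P[pq pB qB].
rewrite linear_sum scaler_sumr; apply: eq_bigr => r rB.
by rewrite linearZ /= theta_e (eps_block b B p q r) // !scalerA mulrC.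
Qed.

Lemma theta_dmul {K : fieldType} {m : nat} (b : block m)
    (delta : decoration m) :
  {morph theta K b : x y / dmul delta x y}.
Proof.
move=> x y; rewrite /dmul linear_sum; apply: eq_bigr => p _.
rewrite linear_sum; apply: eq_bigr => q _.
rewrite linearZ /= theta_dmul_basis !theta_coord scalerA.
by congr (_ *: _); rewrite mulrC [RHS]mulrACA.
Qed.

Lemma mem_VS {K : fieldType} {m : nat} (S : {set point m}) (x : dvect K m) :
  reflect (forall p, p \notin S -> x p = 0) (x \in VS K S).
Proof.
apply: (iffP idP) => [xS p pS|x0].
  (* The coordinate at [p] is a linear form killing every generator, so the span lies in its
     kernel. *)
  pose f (y : dvect K m) : K^o := y p.
  have f_lin : linear f by move=> a u v; rewrite /f !ffunE.
  pose fL := GRing.isLinear.Build K (dvect K m) K^o *:%R f f_lin.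
  pose F : {linear dvect K m -> K^o} := HB.pack f fL.
  suff /subvP/(_ x xS) : (VS K S <= lker (linfun F))%VS.
    by rewrite memv_ker lfunE => /eqP.
  apply/span_subvP => _ /imageP[q qS ->]; rewrite memv_ker lfunE /= /f ffunE.
  have /negbTE-> : p != q by apply: contraNneq pS => ->.
  by rewrite eqxx.
rewrite [x]dvect_sum_e; apply: memv_suml => p _.
have [pS|/x0->] := boolP (p \in S); last by rewrite scale0r mem0v.
by apply/memvZ/memv_span/image_f.
Qed.

Lemma VST (K : fieldType) (m : nat) : VS K [set: point m] = fullv.
Proof. by apply/vspaceP => x; rewrite memvf; apply/mem_VS => p; rewrite inE. Qed.

Lemma VSS {K : fieldType} {m : nat} (S T : {set point m}) :
  S \subset T -> (VS K S <= VS K T)%VS.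
Proof.
move=> ST; apply/subvP => x /mem_VS xS; apply/mem_VS => p pT.
by apply: xS; apply: contra pT; apply/subsetP.
Qed.

Lemma VSI0 {K : fieldType} {m : nat} (S T : {set point m}) :
  [disjoint S & T] -> (VS K S :&: VS K T)%VS = 0%VS.
Proof.
move=> dST; apply/eqP; rewrite -subv0; apply/subvP => x.
rewrite memv_cap memv0 => /andP[/mem_VS xS /mem_VS xT].
apply/eqP/ffunP => p; rewrite ffunE; have [pS|/xS//] := boolP (p \in S).
by apply: xT; rewrite (disjointFr dST).
Qed.

Lemma VS_bigcup {K : fieldType} {m : nat} (I : finType) (P : pred I)
    (F : I -> {set point m}) :
  VS K (\bigcup_(i | P i) F i) = (\sum_(i | P i) VS K (F i))%VS.
Proof.
apply/eqP; rewrite eqEsubv; apply/andP; split.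
  apply/span_subvP => _ /imageP[p /bigcupP[i Pi pFi] ->].
  apply: (subvP (sumv_sup i Pi (subvv _))).
  by apply/memv_span/image_f.
by apply/subv_sumP => i Pi; apply: VSS; apply: bigcup_sup.
Qed.

Lemma VSU {K : fieldType} {m : nat} (S T : {set point m}) :
  VS K (S :|: T) = (VS K S + VS K T)%VS.
Proof.
have := @VS_bigcup K m bool xpredT (fun c => if c then S else T).
by rewrite !big_bool.
Qed.

Lemma directv_VS {K : fieldType} {m : nat} (I : finType) (A : {set I})
    (F : I -> {set point m}) :
  {in A &, forall r s, r != s -> [disjoint F r & F s]} ->
  directv (\sum_(r in A) VS K (F r)).
Proof.
move=> dF; apply/directv_sumP => r rA.
rewrite -VS_bigcup; apply: VSI0.
apply/bigcup_disjointP => s /andP[sA sr].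
by apply: dF; rewrite // eq_sym.
Qed.

(** Coordinatewise the eigenvector equation is [(eps K b p - a) * x p = 0], which forces [x p = 0]
    exactly where [eps K b p] differs from [a]. *)
Lemma leigenspace_theta {K : fieldType} {m : nat} (b : block m) (a : K) :
  passmx.leigenspace (theta K b) a = VS K [set p | eps K b p == a].
Proof.
apply/vspaceP => x; rewrite memv_ker.
rewrite add_lfunE opp_lfunE scale_lfunE id_lfunE subr_eq0.
apply/eqP/mem_VS => [xE p|x0]; last first.
  apply/ffunP => p; rewrite theta_coord !ffunE.
  have := x0 p; rewrite inE; case: eqP => [-> //|_ -> //].
  by rewrite mulr0 scaler0.
rewrite inE => ea; apply/eqP; have := congr1 (fun y : dvect K m => y p) xE.
rewrite /= theta_coord ffunE => /eqP.
by rewrite -subr_eq0 -mulrBl mulf_eq0 subr_eq0 (negbTE ea).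
Qed.

(** This is where the characteristic enters: the two signs must be distinct for the level sets of
    [eps] to be disjoint. *)
Lemma pchar0_eqN1 (K : fieldType) :
  [pchar K] =i pred0 -> (-1 == 1 :> K) = false.
Proof.
move=> charK; apply/negbTE; have := charK 2%N; rewrite !inE /=.
by apply: contraFN; rewrite eq_sym -addr_eq0.
Qed.

Lemma eps_eq1 {K : fieldType} {m : nat} (b : block m) (p : point m)
    (x y : 'I_m) :
  [pchar K] =i pred0 -> x != y -> val p = [set x; y] ->
  (eps K b p == 1) = ((x \in supp b) == (y \in supp b)).
Proof.
move=> charK xy pE; rewrite (epsE _ _ _ _ xy pE) -signr_addb.
by case: (x \in _); case: (y \in _); rewrite ?eqxx //= pchar0_eqN1.
Qed.

Lemma eps_eqN1 {K : fieldType} {m : nat} (b : block m) (p : point m) :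
  [pchar K] =i pred0 -> (eps K b p == -1) = (eps K b p != 1).
Proof.
move=> charK; rewrite /eps -signr_odd; case: (odd _).
  by rewrite eqxx pchar0_eqN1.
by rewrite eqxx eq_sym pchar0_eqN1.
Qed.

Lemma mem_star {m : nat} (i j k r : 'I_m) (p : point m) :
  (p \in points [:: [set i; r]; [set j; r]; [set k; r]])
    = [exists t in [set i; j; k], val p == [set t; r]].
Proof.
rewrite !inE; apply/or3P/exists_inP => [|[t]].
  by case=> pE; [exists i | exists j | exists k]; rewrite // !inE eqxx ?orbT.
by rewrite !inE -orbA => /or3P[] /eqP-> pE;
  [apply: Or31 | apply: Or32 | apply: Or33].
Qed.

Theorem corollary2p3 (K : fieldType) (charK : [pchar K] =i pred0)
    (m : nat) (m_ge3 : (3 <= m)%N)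
    (b : block m) (i j k : 'I_m) (suppb : supp b = [set i; j; k])
    (delta : decoration m) :
  let R : {set 'I_m} := ~: [set i; j; k] in
  let P0 : {set point m} := val b in
  let W (r : 'I_m) := points [:: [set i; r]; [set j; r]; [set k; r]] in
  let P1 := \bigcup_(r in R) W r in
  let P2 := [set p : point m |
    [exists r in R, [exists s in R, (r != s) && (val p == [set r; s])]]] in
  let Aplus := passmx.leigenspace (theta K b) 1 in
  let Aminus := passmx.leigenspace (theta K b) (-1) in
  [/\ automorphism delta (theta K b) /\ involutive (theta K b),
      P0 = points [:: [set i; j]; [set i; k]; [set j; k]] /\
      {in R &, forall r s, r != s -> [disjoint W r & W s]},
      fullv = (Aplus + Aminus)%VS /\ directv (Aplus + Aminus),
      Aplus = (VS K P0 + VS K P2)%VS /\ directv (VS K P0 + VS K P2) &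
      [/\ Aminus = VS K P1,
          VS K P1 = (\sum_(r in R) VS K (W r))%VS
        & directv (\sum_(r in R) VS K (W r))]].
Proof.
move=> R P0 W P1 P2 Aplus Aminus.
have [_ P0E] := block_suppE b.
have [c3 _] := block_suppE b; rewrite suppb in c3.
(* A common point would be [[set t; r] = [set u; s]] with [u] in the triple; since [r != s], this
   gives [r = u], against [r \in R]. *)
have disW : {in R &, forall r s, r != s -> [disjoint W r & W s]}.
  move=> r s rR sR rs; apply/pred0P => p /=; apply/negP.
  rewrite !mem_star => /andP[/exists_inP[t tT /eqP->] /exists_inP[u uT]].
  move=> /eqP/setP/(_ r); rewrite !inE eqxx orbT (negbTE rs) orbF.
  by move=> /esym/eqP rE; move: rR; rewrite inE rE uT.
(* The sign is -1 when exactly one end of [p] is in the triple; the other end is then the index [r]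
   of the set [W r] containing [p]. *)
have NP1 : [set p | eps K b p == -1] = P1.
  apply/setP => p; have [x [y [xy pE]]] := point_pair p.
  rewrite inE eps_eqN1 // (eps_eq1 b p x y) // suppb.
  apply/idP/bigcupP => [|[r rR]].
    have [xT|xT] := boolP (x \in [set i; j; k]);
      have [yT|yT] //= := boolP (y \in [set i; j; k]) => _.
      exists y; first by rewrite inE.
      by rewrite mem_star; apply/exists_inP; exists x => //; rewrite pE.
    exists x; first by rewrite inE.
    by rewrite mem_star; apply/exists_inP; exists y => //; rewrite pE setUC.
  rewrite mem_star => /exists_inP[t tT]; rewrite pE => /eqP xyE.
  move: rR; rewrite inE => rT.
  have tr : t != r by apply: contraNneq rT => <-.
  have := set21 x y; have := set22 x y; rewrite {}xyE !inE.
  move: xy tT rT; rewrite !inE.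
  by move=> xy tT rT /orP[]/eqP yE /orP[]/eqP xE;
     move: xy; rewrite xE yE ?eqxx // ?tT (negbTE rT).
(* The sign is 1 when both ends lie in the triple ([P0]) or both lie in [R] ([P2]). *)
have PP : [set p | eps K b p == 1] = P0 :|: P2.
  apply/setP => p; have [x [y [xy pE]]] := point_pair p.
  rewrite inE (eps_eq1 b p x y) // !in_setU /P0 P0E inE suppb pE subUset !sub1set.
  have -> : (p \in P2) = (x \in R) && (y \in R).
    rewrite inE; apply/exists_inP/andP => [[r rR /exists_inP[s sR]]|[xR yR]].
      rewrite pE => /andP[_ /eqP xyE].
      have := set21 x y; have := set22 x y; rewrite {}xyE !in_set2.
      by move=> /orP[]/eqP-> /orP[]/eqP->.
    by exists x => //; apply/exists_inP; exists y; rewrite // xy pE eqxx.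
  by rewrite /R !in_setC; do 2 case: (_ \in [set i; j; k]).
have dis02 : [disjoint P0 & P2].
  rewrite disjoint_sym; apply/pred0P => p /=; apply/negP => /andP[].
  rewrite inE /P0 P0E inE suppb => /exists_inP[r rR /exists_inP[s sR]].
  move=> /andP[_ /eqP->]; rewrite subUset !sub1set => /andP[rT _].
  by move: rR; rewrite inE rT.
have ApE : Aplus = (VS K P0 + VS K P2)%VS.
  by rewrite /Aplus leigenspace_theta PP VSU.
have AmE : Aminus = VS K P1 by rewrite /Aminus leigenspace_theta NP1.
split.
- split; last exact: theta_invol.
  by split; [apply: inv_bij; apply: theta_invol | apply: theta_dmul].
- split=> //; apply/setP => p.
  (* Distinctness of the three names follows from the support having three elements. *)
  have [ij ik jk] : [/\ i != j, i != k & j != k].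
    move: c3; rewrite setUC cardsU1 cards2 !inE negb_or.
    by rewrite [k == i]eq_sym [k == j]eq_sym; do 3 case: (_ == _).
  by rewrite /P0 P0E inE suppb -(mem_triple p ij ik jk).
- rewrite /Aplus /Aminus !leigenspace_theta; split.
    rewrite -VSU -VST; congr (VS K _); apply/setP => p.
    by rewrite !inE eps_eqN1 // orbN.
  apply/directv_addP/VSI0/pred0P => p /=.
  by rewrite !inE eps_eqN1 // andbN.
- by split=> //; apply/directv_addP/VSI0.
- by split=> //; [apply: VS_bigcup | apply: directv_VS].
Qed.
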